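(* Let $k\ge 2$ and $n\ge 1$. For a $k$-colored partition $\lambda=(\lambda_1,\dots,\lambda_t)$ of $n$ define $p_{-k}(\lambda)=\prod_{j=1}^t p_{-k}(\lambda_j)$ (depending only on the part sizes), and let $\max p_{-k}(n)$ be the maximum of $p_{-k}(\lambda)$ over all $k$-colored partitions $\lambda$ of $n$. Then the maximum is attained exactly at the $k$-colored partitions whose multiset of part sizes is as follows: 1) $k=2$: $(2,2,\dots,2)$ when $n$ is even; $(3,2,\dots,2)$ or $(2,2,\dots,2,1)$ when $n$ is odd. Moreover $\max p_{-2}(n)=5^{n/2}$ if $n$ is even and $\max p_{-2}(n)=2\cdot 5^{(n-1)/2}$ if $n$ is odd. 2) $k=3$: $(\underbrace{2,\dots,2}_{m},\underbrace{1,\dots,1}_{l})$ for any $m,l\ge0$ with $2m+l=n$. Moreover $\max p_{-3}(n)=3^n$. 3) $k\ge 4$: $(1,1,\dots,1)$. Moreover $\max p_{-k}(n)=k^n$.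
   Context: A $k$-colored partition of $n$ is a partition of $n$ in which each part is assigned one of $k$ colors $1,\dots,k$ (two such are equal iff they have the same multiset of (size, color) pairs). $p_{-k}(m)$ denotes the number of $k$-colored partitions of $m$, i.e. $\sum_{m\ge0}p_{-k}(m)q^m=\prod_{i\ge1}(1-q^i)^{-k}$. *)

(* Defs.v *)
From HB Require Import structures.
From mathcomp Require Import all_boot finmap multiset.

Set Implicit Arguments.
Unset Strict Implicit.
Unset Printing Implicit Defensive.

Local Open Scope nat_scope.
Local Open Scope mset_scope.

(* Parts are (size, color) pairs; the k colors are indexed from 0, as 'I_k. *)
Definition is_colored_partition (k n : nat) (L : {mset nat * 'I_k}) : bool :=
  all (fun x => 0 < x.1) L && (\sum_(x <- L) x.1 == n).

Record colored_partition (k n : nat) : Type := ColoredPartition {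
  cpval :> {mset nat * 'I_k};
  cpvalP : is_colored_partition n cpval
}.

HB.instance Definition _ k n := [isSub for @cpval k n].
HB.instance Definition _ k n := [Choice of colored_partition k n by <:].

(* A colored partition of n has at most n parts, all of size at most n; hence
   there are finitely many of them. *)
Section Finiteness.
Variables k n : nat.
Implicit Type L : colored_partition k n.

Definition cp_encode L : {bseq n of 'I_n.+1 * 'I_k} :=
  insub_bseq n [seq (inord x.1, x.2) | x <- enum_mset (cpval L)].

Definition cp_decode (s : {bseq n of 'I_n.+1 * 'I_k}) :
    option (colored_partition k n) :=
  insub (seq_mset [seq (val x.1, x.2) | x <- s]).

Lemma cp_encodeK : pcancel cp_encode cp_decode.
Proof.
case=> L PL; have /andP[/allP Lgt0 /eqP sumL] := PL.
have szL : size (enum_mset L) <= n.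
  rewrite -sum1_size -sumL big_seq [leqRHS]big_seq.
  by apply: leq_sum => x /Lgt0.
have leL x : x \in enum_mset L -> x.1 < n.+1.
  by move=> xL; rewrite ltnS -sumL (big_rem x) //= leq_addr.
rewrite /cp_decode /cp_encode /insub_bseq /=.
rewrite insubdK ?unfold_in ?size_map // -map_comp map_id_in; last first.
  by case=> a c /leL /= lt_an; rewrite inordK.
by rewrite seq_mset_id (insubT (is_colored_partition n) PL).
Qed.

HB.instance Definition _ : isCountable (colored_partition k n) :=
  PCanIsCountable cp_encodeK.
HB.instance Definition _ : isFinite (colored_partition k n) :=
  PCanIsFinite cp_encodeK.
End Finiteness.

(* The number p_{-k}(m). *)
Definition pk (k m : nat) : nat := #|{: colored_partition k m}|.

Definition part_sizes (k n : nat) (L : colored_partition k n) : seq nat :=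
  [seq x.1 | x <- enum_mset (cpval L)].

(* The multiplicative extension p_{-k}(lambda). *)
Definition pk_ext (k n : nat) (L : colored_partition k n) : nat :=
  \prod_(s <- part_sizes L) pk k s.

Definition max_pk (k n : nat) : nat :=
  \max_(L : colored_partition k n) pk_ext L.

Definition has_sizes (k n : nat) (s : seq nat) (L : colored_partition k n) :
    bool := perm_eq (part_sizes L) s.

Definition maximizer (k n : nat) (L : colored_partition k n) : Prop :=
  pk_ext L = max_pk k n.

(* Main.v *)
(* Each p_{-k}(s) is compared with a supermultiplicative bound f: f s = k ^ s
   for k >= 3, and f s = 5 ^ (s / 2) or 2 * 5 ^ ((s - 1) / 2) for k = 2.
   Counting the total size of all parts of all k-colored partitions of m in two
   ways gives m p(m) = k \sum_(1 <= r <= m) sigma(r) p(m - r).  Inductively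
   p(m - r) <= f (m - r), so once k sigma(r) <= f r each term is at most
   f r * f (m - r) <= f m; hence p(m) <= f m, and a single strict inequality
   k sigma(j) < f j makes p(m) < f m for all m >= j.  Multiplying over the parts
   of a partition, equality holds iff every part s has p(s) = f s and, for k = 2,
   at most one part is odd. *)
Require Import Defs.
From mathcomp Require Import all_boot finmap multiset.
From mathcomp Require Import zify.

Set Implicit Arguments.
Unset Strict Implicit.
Unset Printing Implicit Defensive.

Local Open Scope nat_scope.

(** * Double counting of parts and the recurrence for [pk] *)

Section Counting.
Local Open Scope mset_scope.
Variable k : nat.

Lemma cp_gt0 m (L : colored_partition k m) x : x \in cpval L -> 0 < x.1.
Proof. by have /andP[/allP + _] := cpvalP L; apply. Qed.

Lemma cp_sum m (L : colored_partition k m) : \sum_(x <- cpval L) x.1 = m.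
Proof. by have /andP[_ /eqP] := cpvalP L. Qed.

Lemma cp_le m (L : colored_partition k m) x : x \in cpval L -> x.1 <= m.
Proof. by move=> xL; rewrite -(cp_sum L) (big_rem x) //= leq_addr. Qed.

Lemma perm_mset1D (T : choiceType) (x : T) (A : {mset T}) :
  perm_eq (x +` A) (x :: A).
Proof.
apply/allP => y _ /=; rewrite !count_mem_mset mset1DE [x == y]eq_sym.
exact: eqxx.
Qed.

Lemma is_colored_partitionD m x (A : {mset nat * 'I_k}) : 0 < x.1 ->
  is_colored_partition (x.1 + m) (x +` A) = is_colored_partition m A.
Proof.
move=> x_gt0; rewrite /is_colored_partition (perm_all _ (perm_mset1D x A)) /=.
by rewrite (perm_big _ (perm_mset1D x A)) big_cons /= eqn_add2l x_gt0.
Qed.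

Definition total_mult m x := \sum_(L : colored_partition k m) cpval L x.

(** Adding a copy of [x] is a bijection from the partitions of [m] onto those of [x.1 + m]
    containing [x], and it raises the multiplicity of [x] by one. *)
Lemma total_multD m x : 0 < x.1 ->
  total_mult (x.1 + m) x = total_mult m x + pk k m.
Proof.
move=> x_gt0.
pose add (L : colored_partition k m) : colored_partition k (x.1 + m) :=
  insubd (ColoredPartition
            (etrans (is_colored_partitionD m (cpval L) x_gt0) (cpvalP L)))
         (x +` cpval L).
have addE L : cpval (add L) = x +` cpval L.
  by rewrite [LHS]insubdK // [_ \in _]is_colored_partitionD // cpvalP.
pose del (L0 : colored_partition k m) (L : colored_partition k (x.1 + m)) :=
  insubd L0 (cpval L `\ x).
have delP (L : colored_partition k (x.1 + m)) :
    x \in cpval L -> is_colored_partition m (cpval L `\ x).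
  by move=> xL; rewrite -(is_colored_partitionD m _ x_gt0) msetB1K // cpvalP.
rewrite /total_mult.
rewrite (bigID (fun L : colored_partition k (x.1 + m) => x \in cpval L)) /=.
rewrite [X in _ + X]big1 ?addn0 => [|L /mset_eq0P //].
(* [del] needs a default partition [L0] of [m]; without one, no partition of [x.1 + m] contains [x]
   and both sides are 0. *)
case: (pickP (fun L : colored_partition k m => true)) => [L0 _ | noL]; last first.
  rewrite /pk (eq_card0 noL) [in RHS]big_pred0 //= big1 // => L xL.
  by have := noL (ColoredPartition (delP _ xL)).
rewrite (reindex_onto add (del L0)) /= => [|L xL]; last first.
  apply: val_inj; rewrite /= addE insubdK ?msetB1K //.
  exact: delP xL.
rewrite /pk -sum1_card -big_split /=; apply: eq_big => L.
  rewrite addE mset1D1 /=; apply/eqP/val_inj => /=.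
  by rewrite /del addE msetD1K insubdK //; apply: cpvalP.
by rewrite addE mset1DE eqxx addnC.
Qed.

Lemma total_mult_eq0 m x : m < x.1 -> total_mult m x = 0.
Proof.
move=> mx; apply: big1 => L _; apply/mset_eq0P; apply: contraL mx => /cp_le.
by rewrite leqNgt.
Qed.

Lemma total_multE m x : 0 < x.1 ->
  total_mult m x = \sum_(1 <= r < m.+1 | x.1 %| r) pk k (m - r).
Proof.
move=> x_gt0; elim/ltn_ind: m => m IH; have [mx | xm] := ltnP m x.1.
  rewrite total_mult_eq0 // big_nat_cond big_pred0 // => r.
  by apply/negP => /andP[/andP[r_gt0 rm] /dvdn_leq]; lia.
rewrite -{1}(subnKC xm) total_multD // IH; last by lia.
(* Up to [x.1] the only positive multiple of [x.1] is itself, which gives the new term; the later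
   [r], shifted down by [x.1], give the inductive sum. *)
rewrite [RHS](big_cat_nat (n := x.1.+1)) //=; try lia.
rewrite [X in _ = X + _]big_mkcond /= big_nat_recr //= dvdnn.
rewrite [X in _ = X + _ + _]big_nat [X in _ = X + _ + _]big1 ?add0n
  => [|r r_lt]; last first.
  by case: ifP => // /dvdn_leq; lia.
rewrite addnC; congr (_ + _).
rewrite -[X in _ = \sum_(X <= _ < _ | _) _]add1n big_addn subSn //.
apply: eq_big => [r | r _]; first by rewrite dvdn_addl.
by congr pk; lia.
Qed.

Definition sigma r := \sum_(1 <= s < r.+1 | s %| r) s.

Lemma pk_rec m :
  m * pk k m = \sum_(1 <= r < m.+1) k * sigma r * pk k (m - r).
Proof.
have -> : m * pk k m =
    \sum_(L : colored_partition k m) \sum_(1 <= s < m.+1) \sum_(c < k)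
      s * cpval L (s, c).
  rewrite /pk -sum1_card big_distrr /=; apply: eq_bigr => L _.
  rewrite muln1 -[LHS](cp_sum L) big_seq.
  transitivity (\sum_(x <- cpval L | x \in cpval L)
     \sum_(1 <= s < m.+1) \sum_(c < k) s * (x == (s, c))).
    apply: eq_bigr => -[s c] xL; have := cp_gt0 xL; have := cp_le xL => /= sm s0.
    rewrite (bigD1_seq s) ?mem_index_iota ?iota_uniq //=; last by lia.
    rewrite (bigD1 c) //= eqxx muln1 !big1 ?addn0 // => [s' s's|c' c'c].
      by apply: big1 => c' _; rewrite xpair_eqE eq_sym (negPf s's) muln0.
    by rewrite xpair_eqE [c == _]eq_sym (negPf c'c) andbF muln0.
  rewrite -big_seq exchange_big /=; apply: eq_bigr => s _.
  rewrite exchange_big /=; apply: eq_bigr => c _.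
  by rewrite -big_distrr /= -count_mem_mset -sum1_count [in RHS]big_mkcond /=.
rewrite exchange_big /=.
transitivity (\sum_(1 <= s < m.+1) \sum_(1 <= r < m.+1 | s %| r)
    k * s * pk k (m - r)).
  rewrite big_nat [RHS]big_nat; apply: eq_bigr => s /andP[s_gt0 _].
  rewrite exchange_big /= -big_distrr /=.
  transitivity (\sum_(c < k) s * \sum_(1 <= r < m.+1 | s %| r) pk k (m - r)).
    apply: eq_bigr => c _.
    by rewrite -big_distrr /= -[X in s * X]/(total_mult m (s, c)) total_multE.
  by rewrite sum_nat_const card_ord mulnA.
(* With [r] outermost, the sizes [s] dividing [r] collect into [sigma r]; sizes above [r] do not
   divide it. *)
rewrite (exchange_big_dep xpredT) //= big_nat [RHS]big_nat.
apply: eq_bigr => r /andP[r_gt0 rm]; rewrite -big_distrl -big_distrr /=.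
congr (k * _ * _); rewrite /sigma [LHS](big_cat_nat (n := r.+1)) //=.
rewrite [X in _ + X]big_nat_cond [X in _ + X]big_pred0 ?addn0 // => s.
by apply/negP => /andP[/andP[rs _] /dvdn_leq]; lia.
Qed.

Lemma pk0 : pk k 0 = 1.
Proof.
have P0 : is_colored_partition 0 (mset0 : {mset nat * 'I_k}).
  by rewrite /is_colored_partition enum_mset0 big_nil.
rewrite /pk; apply: (@eq_card1 _ (ColoredPartition P0)) => L.
rewrite !inE; apply/esym/eqP/val_inj/msetP => x /=; rewrite mset0E.
by apply/mset_eq0P/negP => xL; have := cp_gt0 xL; have := cp_le xL; lia.
Qed.

End Counting.

(** * Small values of [pk] and strict upper bounds *)

Section Bounds.
Variable k : nat.

Lemma pk1 : pk k 1 = k.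
Proof.
by have := pk_rec k 1; rewrite big_nat1 subnn pk0 /sigma unlock /= mul1n !muln1.
Qed.

Lemma pk2 : 2 * pk k 2 = k * (k + 3).
Proof. rewrite pk_rec /sigma unlock /= pk1 pk0; lia. Qed.

Lemma pk3 : 3 * pk k 3 = k * pk k 2 + 3 * (k * k) + 4 * k.
Proof. rewrite pk_rec /sigma unlock /= pk1 pk0 subn1 /=; lia. Qed.

(** Below [j] the inequality [k * sigma r <= f r] may fail (for [k = 2] it does at [r = 2], where 6
    > 5), so the first [j - 1] terms of the recurrence are bounded only in total, by [init]. Term
    [j] gives strictness, and [fr] with [fM] bounds each later term. *)
Lemma pk_lt (j : nat) (f : nat -> nat) : 0 < j ->
  (forall m, 0 < f m) -> (forall a b, f a * f b <= f (a + b)) ->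
  (forall i, i < j -> pk k i <= f i) ->
  k * sigma j < f j -> (forall r, j < r -> k * sigma r <= f r) ->
  (forall m, j <= m ->
     \sum_(1 <= r < j) k * sigma r * f (m - r) <= j.-1 * f m) ->
  forall m, j <= m -> pk k m < f m.
Proof.
move=> j_gt0 f_gt0 fM base fj fr init; elim/ltn_ind=> m IH jm.
have pk_le i : i < m -> pk k i <= f i.
  by case: (ltnP i j) => [/base //|ji im]; apply/ltnW/IH.
have m_gt0 : 0 < m by exact: leq_trans jm.
rewrite -(ltn_pmul2l m_gt0) pk_rec.
have {pk_le} le_f : \sum_(1 <= r < m.+1) k * sigma r * pk k (m - r) <=
    \sum_(1 <= r < m.+1) k * sigma r * f (m - r).
  rewrite big_nat [leqRHS]big_nat; apply: leq_sum => r /andP[r_gt0 _].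
  by rewrite leq_mul2l pk_le ?orbT //; lia.
apply: leq_ltn_trans le_f _.
rewrite (big_cat_nat (n := j)) //=; last by lia.
rewrite [X in _ + X]big_ltn //.
have lt_j : k * sigma j * f (m - j) < f m.
  apply: leq_trans (_ : f j * f (m - j) <= _); first by rewrite ltn_pmul2r.
  by rewrite -{2}(subnKC jm) fM.
have le_tail : \sum_(j.+1 <= r < m.+1) k * sigma r * f (m - r) <= (m - j) * f m.
  rewrite -subSS -sum_nat_const_nat big_nat [leqRHS]big_nat; apply: leq_sum => r.
  move=> /andP[jr rm].
  apply: leq_trans (_ : f r * f (m - r) <= _); first by rewrite leq_mul2r fr ?orbT.
  by rewrite -{2}(subnKC (_ : r <= m)).
have := init _ jm.
have -> : m * f m = j.-1 * f m + (f m + (m - j) * f m).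
  by rewrite -mulSn -mulnDl; congr (_ * _); lia.
nia.
Qed.

Lemma sigma_le_sqr r : sigma r <= r * r.
Proof.
have -> : r * r = \sum_(1 <= s < r.+1) r by rewrite sum_nat_const_nat subn1.
rewrite /sigma big_mkcond /=.
rewrite big_nat [leqRHS]big_nat; apply: leq_sum => s /andP[_ sr].
by case: ifP.
Qed.

End Bounds.

(** The quadratic bound suffices from [sigma 3] on: 9 = 3 ^ 2, and the squares then grow by a factor
    below 3. The exponent is one short so that the factor [k] of the recurrence can be absorbed. *)
Lemma sigma_le_expn3 r : sigma r.+1 <= 3 ^ r.
Proof.
case: r => [|[|r]]; try by rewrite /sigma unlock.
apply: leq_trans (sigma_le_sqr _) _.
elim: r => // r IH; rewrite expnS; apply: leq_trans (leq_mul (leqnn 3) IH).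
nia.
Qed.

Lemma pk_lt_expn4 k m : 4 <= k -> 2 <= m -> pk k m < k ^ m.
Proof.
move=> k4; move: m; apply: pk_lt => //.
- by move=> i; rewrite expn_gt0; lia.
- by move=> a b; rewrite expnD.
- by case=> [|[|//]] _; rewrite ?pk0 ?pk1.
(* As [sigma 2 = 3], the claim [k * 3 < k ^ 2] amounts to [3 < k]. *)
- by rewrite /sigma unlock /= expnS expn1; nia.
- case=> // r _; rewrite expnS leq_mul2l (leq_trans (sigma_le_expn3 r)) ?orbT //.
  by case: r => // r; rewrite leq_exp2r //; lia.
- move=> m2 m2_gt; rewrite big_nat1 /sigma unlock /= muln1 mul1n -expnS.
  by rewrite subn1 prednK //; lia.
Qed.

Lemma pk3_2 : pk 3 2 = 9.
Proof. have := pk2 3; lia. Qed.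

Lemma pk_lt_expn3 m : 3 <= m -> pk 3 m < 3 ^ m.
Proof.
move: m; apply: pk_lt => //.
- by move=> i; rewrite expn_gt0.
- by move=> a b; rewrite expnD.
- by case=> [|[|[|//]]] _; rewrite ?pk0 ?pk1 ?pk3_2.
- by rewrite /sigma unlock.
- by case=> // r _; rewrite expnS leq_mul2l sigma_le_expn3 orbT.
(* Since [sigma 1 = 1] and [sigma 2 = 3], the first two terms both equal [3 ^ m] exactly. *)
- case=> [|[|[|m]]] // _; rewrite /sigma unlock /= !subSS !subn0 !expnS; lia.
Qed.

(** The coercion of [odd n] to an exponent 0 or 1 merges the two parity cases into one formula. *)
Definition bound2 n := 2 ^ odd n * 5 ^ n./2.

Lemma bound2SS n : bound2 n.+2 = 5 * bound2 n.
Proof. by rewrite /bound2 /= negbK expnS mulnCA. Qed.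

Lemma bound2_gt0 n : 0 < bound2 n.
Proof. by rewrite muln_gt0 !expn_gt0. Qed.

(** Only two odd arguments lose: their factors 2 * 2 = 4 face the extra 5 from the carry in
    [halfD]. *)
Lemma bound2M a b :
  bound2 a * bound2 b <= bound2 (a + b) ?= iff ~~ (odd a && odd b).
Proof.
have E : bound2 a * bound2 b = 2 ^ (odd a + odd b) * 5 ^ (a./2 + b./2).
  by rewrite /bound2 !expnD mulnACA.
rewrite E /bound2 oddD halfD; have : 0 < 5 ^ (a./2 + b./2) by rewrite expn_gt0.
rewrite (expnD 5 (odd a && odd b)); move: (5 ^ (a./2 + _)) => x x_gt0.
by case: (odd a) (odd b) => [] [] /=; split; lia.

Qed.

Lemma pk2_2 : pk 2 2 = 5.
Proof. have := pk2 2; lia. Qed.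

Lemma pk2_3 : pk 2 3 = 10.
Proof. have := pk3 2; rewrite pk2_2; lia. Qed.

(** The bound [2 * r ^ 2] is tight at [r = 5], where both sides are 50; a step of two multiplies
    [bound2] by 5 and the square by less. *)
Lemma sigma_le_bound2 r : 4 < r -> 2 * sigma r <= bound2 r.
Proof.
move=> r4; apply: leq_trans (leq_mul (leqnn 2) (sigma_le_sqr r)) _.
rewrite -(subnKC r4); elim/ltn_ind: (r - 5) => -[|[|i]] // IH.
rewrite !addnS bound2SS; apply: leq_trans (leq_mul (leqnn 5) (IH i _)); nia.
Qed.

Lemma pk2_lt m : 4 <= m -> pk 2 m < bound2 m.
Proof.
move: m; apply: pk_lt => //.
- exact: bound2_gt0.
- by move=> a b; apply: bound2M.
- by case=> [|[|[|[|//]]]] _; rewrite ?pk0 ?pk1 ?pk2_2 ?pk2_3.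
- by rewrite /sigma unlock.
- exact: sigma_le_bound2.
(* The term [r = 2] is too large, with coefficient 6 against 5; the slack at [r = 3], with 8 against
   10, makes up for it. The instance of [bound2M] reads [2 * bound2 m.+1 <= 5 * bound2 m]. *)
- case=> [|[|[|[|m]]]] // _; rewrite /sigma unlock /= !subSS !subn0.
  have := (bound2M m.+1 1).1; rewrite addn1 !bound2SS (_ : bound2 1 = 2) //; lia.
Qed.

Lemma pk_leq_expn k m : 3 <= k -> pk k m <= k ^ m.
Proof.
move=> k3; have [k_eq|k4] : k = 3 \/ 4 <= k by lia.
  rewrite {}k_eq; case: (ltnP 2 m) => [/pk_lt_expn3/ltnW // |].
  by case: m => [|[|[|//]]]; rewrite ?pk0 ?pk1 ?pk3_2.
case: (ltnP 1 m) => [/(pk_lt_expn4 k4)/ltnW // |].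
by case: m => [|[|//]]; rewrite ?pk0 ?pk1.
Qed.

Lemma pk2_leq m : pk 2 m <= bound2 m ?= iff (m <= 3).
Proof.
case: (ltnP 3 m) => [/pk2_lt lt_f|].
  by split; [exact: ltnW | rewrite ltn_eqF].
by case: m => [|[|[|[|//]]]] _; apply/leqifP; rewrite ?pk0 ?pk1 ?pk2_2 ?pk2_3.
Qed.

(** * Bounds on products over the parts, with their equality cases *)

Lemma prod_pk_leq_expn k (l : seq nat) : 3 <= k ->
  \prod_(s <- l) pk k s <= k ^ sumn l ?= iff all (fun s => pk k s == k ^ s) l.
Proof.
move=> k3; elim: l => [|s l IH] /=; first by rewrite big_nil; split.
rewrite big_cons expnD.
have := leqif_mul (leqif_eq (pk_leq_expn s k3)) IH.
(* [leqif_mul] also allows equality when the bound is 0, which [3 <= k] excludes. *)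
by rewrite muln_eq0 !expn_eq0 (_ : (k == 0) = false) //; lia.
Qed.

Lemma odd_sumn_count l : odd (sumn l) = odd (count odd l).
Proof. by elim: l => //= s l IH; rewrite !oddD IH; case: (odd s). Qed.

Lemma prod_pk2_leq (l : seq nat) :
  \prod_(s <- l) pk 2 s <= bound2 (sumn l)
    ?= iff all (fun s => s <= 3) l && (count odd l <= 1).
Proof.
elim: l => [|s l IH] /=; first by rewrite big_nil; split.
rewrite big_cons.
have := leqif_trans (leqif_mul (pk2_leq s) IH) (bound2M s (sumn l)).
rewrite muln_eq0 !gtn_eqF ?bound2_gt0 //= odd_sumn_count.
(* If the tail has at most one odd part, its sum is odd iff it has exactly one; so [s] joins it
   without loss iff at most one part is odd overall. *)
congr (leqif _ _ _); rewrite -!andbA; congr (_ && (_ && _)).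
by case: (odd s); case: (count odd l) => [|[|n]] //=; rewrite !andbF.
Qed.

(** * From attained bounds to maximizers, and shapes of part-size lists *)

Section Maximum.
Variables k n : nat.
Implicit Type L : colored_partition k n.

Lemma part_sizes_gt0 L : all (leq 1) (part_sizes L).
Proof. by rewrite all_map; apply/allP => x /cp_gt0. Qed.

Lemma sumn_part_sizes L : sumn (part_sizes L) = n.
Proof. by rewrite sumnE big_map cp_sum. Qed.

(** Giving every part the color [ord0] realizes the sizes; this shows that the bounds are
    attained. *)
Lemma of_sizes (s : seq nat) : 0 < k -> all (leq 1) s -> sumn s = n ->
  exists L, has_sizes s L.
Proof.
case: k => // k' _ s_gt0 s_sum.
pose sc := [seq (i, ord0 : 'I_k'.+1) | i <- s].
have P : is_colored_partition n (seq_mset sc).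
  rewrite /is_colored_partition (perm_all _ (perm_eq_seq_mset _)).
  rewrite (perm_big _ (perm_eq_seq_mset _)) /= big_map all_map -s_sum sumnE eqxx.
  by rewrite andbT; apply: sub_all s_gt0.
exists (ColoredPartition P); rewrite /has_sizes /part_sizes /=.
apply: perm_trans (perm_map _ (perm_eq_seq_mset _)) _.
by rewrite -map_comp map_id.
Qed.

Lemma max_pkP (B : nat) (C : pred (colored_partition k n)) :
  (forall L, pk_ext L <= B ?= iff C L) -> (exists L, C L) ->
  (forall L, maximizer L <-> C L) /\ max_pk k n = B.
Proof.
move=> le_B [L0 CL0].
have maxB : max_pk k n = B.
  apply/eqP; rewrite eqn_leq; apply/andP; split.
    by apply/bigmax_leqP => L _; apply: le_B.
  have /eqP <- : pk_ext L0 == B by rewrite (le_B L0).2.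
  exact: leq_bigmax.
split=> // L; rewrite /maximizer maxB -(le_B L).2.
by split=> /eqP.
Qed.

End Maximum.

(** As [x] is positive, the sum of a constant list determines its length. *)
Lemma perm_all_nseq (l : seq nat) x m : 0 < x -> sumn l = m * x ->
  all (pred1 x) l = perm_eq l (nseq m x).
Proof.
move=> x_gt0 suml; apply/idP/idP => [/all_pred1P El | /perm_all ->].
  suff <- : size l = m by rewrite -El.
  by apply/eqP; rewrite -(eqn_pmul2r x_gt0) -suml El sumn_nseq size_nseq mulnC.
exact: all_pred1_nseq.
Qed.

Lemma perm_nseq21 (l : seq nat) : all (leq 1) l -> all (fun s => s <= 2) l ->
  perm_eq l (nseq (count_mem 2 l) 2 ++ nseq (count_mem 1 l) 1).
Proof.
move=> /allP l_gt0 /allP l_le2; apply/allP => x.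
rewrite !mem_cat !mem_nseq /= count_cat !count_nseq /= => x_in.
have {x_in} [-> | ->] : x = 1 \/ x = 2.
  case/or3P: x_in => [xl | /andP[_ /eqP] | /andP[_ /eqP]]; try by lia.
  by have := l_gt0 _ xl; have := l_le2 _ xl; lia.
all: by rewrite /= ?mul1n ?addn0.
Qed.

Lemma all_count_odd0 l : all (leq 1) l ->
  all (fun s => s <= 3) l && (count odd l == 0) = all (pred1 2) l.
Proof.
elim: l => //= s l IH /andP[s_gt0 /IH <-].
by case: s s_gt0 => [|[|[|[|s]]]] //=; rewrite ?andbF.
Qed.

(** An odd sum forces exactly one odd part, which is 1 or 3; once it is removed, all parts are 2.
    The conjunct [0 < m] keeps [m.-1] from truncating. *)
Lemma count_odd1P l m : all (leq 1) l -> sumn l = m.*2.+1 ->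
  all (fun s => s <= 3) l && (count odd l <= 1) <->
  (0 < m /\ perm_eq l (3 :: nseq m.-1 2)) \/ perm_eq l (rcons (nseq m 2) 1).
Proof.
move=> l_gt0 suml; split; last first.
  move=> [[_ pl]|pl]; rewrite (perm_all _ pl) (permP pl).
    by rewrite /= all_nseq count_nseq orbT.
  by rewrite all_rcons -cats1 count_cat count_nseq all_nseq orbT.
case/andP=> l_le3 cl.
have {}cl : count odd l = 1.
  have := odd_sumn_count l; rewrite suml /= odd_double /=.
  by case: (count odd l) cl => [|[]].
have /hasP[x xl x_odd] : has odd l by rewrite has_count cl.
have pl := perm_to_rem xl.
move: l_gt0 l_le3 cl suml.
rewrite (perm_all _ pl) (perm_all _ pl) (permP pl) (perm_sumn pl) /= x_odd add1n.
case/andP=> x_gt0 r_gt0 /andP[x_le3 r_le3] [/eqP r_even] suml.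
have r2 : all (pred1 2) (rem x l) by rewrite -all_count_odd0 // r_le3.
case: x x_odd xl pl x_gt0 x_le3 r2 suml {r_gt0 r_le3 r_even}
  => [|[|[|[|//]]]] // _ xl pl _ _ r2 suml.
  right; apply: perm_trans pl _; rewrite perm_sym perm_rcons perm_cons perm_sym.
  by rewrite -perm_all_nseq //; lia.
left; split; first by lia.
apply: perm_trans pl _; rewrite perm_cons -perm_all_nseq //; lia.
Qed.

(** * The three ranges of [k] *)

Section Maximizers.
Variable n : nat.

Lemma maximizer2P :
  (forall L : colored_partition 2 n, maximizer L <->
     all (fun s => s <= 3) (part_sizes L) && (count odd (part_sizes L) <= 1))
  /\ max_pk 2 n = bound2 n.
Proof.
apply: max_pkP => [L|].
  rewrite -[in bound2 n](sumn_part_sizes L) -[pk_ext L]/(\prod_(s <- _) _).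
  exact: prod_pk2_leq.
(* The witness has only parts 2, plus a single 1 when [n] is odd. *)
have [|| L /[dup] LP /perm_all E] :=
    @of_sizes 2 n (nseq (odd n) 1 ++ nseq n./2 2) isT.
- by rewrite all_cat !all_nseq !orbT.
- by rewrite sumn_cat !sumn_nseq; lia.
exists L; rewrite E (permP LP) count_cat !count_nseq all_cat !all_nseq !orbT /=.
by case: odd.
Qed.

Lemma maximizer3P :
  (forall L : colored_partition 3 n, maximizer L <->
     all (fun s => s <= 2) (part_sizes L)) /\ max_pk 3 n = 3 ^ n.
Proof.
have pk_eq s : (pk 3 s == 3 ^ s) = (s <= 2).
  case: (ltnP 2 s) => [/pk_lt_expn3/ltn_eqF // |].
  by case: s => [|[|[|//]]]; rewrite ?pk0 ?pk1 ?pk3_2.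
apply: max_pkP => [L|].
  rewrite -(eq_all pk_eq) -[in 3 ^ n](sumn_part_sizes L).
  exact: prod_pk_leq_expn.
have [|| L /perm_all E] := @of_sizes 3 n (nseq n 1) isT.
- by rewrite all_nseq orbT.
- by rewrite sumn_nseq mul1n.
by exists L; rewrite E all_nseq orbT.
Qed.

Lemma maximizer4P k : 4 <= k ->
  (forall L : colored_partition k n, maximizer L <->
     has_sizes (nseq n 1) L) /\ max_pk k n = k ^ n.
Proof.
move=> k4.
(* Positivity excludes [s = 0], where [pk k 0 = 1 = k ^ 0] is an equality too. *)
have pk_eq s : 0 < s -> (pk k s == k ^ s) = (s == 1).
  case: (ltnP 1 s) => [s2 _|].
    by rewrite (ltn_eqF (pk_lt_expn4 k4 s2)) gtn_eqF.
  by case: s => [|[|//]]; rewrite // pk1 expn1 !eqxx.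
apply: max_pkP => [L|]; last first.
  apply: of_sizes; first by lia.
  - by rewrite all_nseq orbT.
  - by rewrite sumn_nseq mul1n.
rewrite /has_sizes -perm_all_nseq ?muln1 ?sumn_part_sizes //.
rewrite -[in k ^ n](sumn_part_sizes L).
have -> : all (pred1 1) (part_sizes L) =
    all (fun s => pk k s == k ^ s) (part_sizes L).
  apply: eq_in_all => s /(allP (part_sizes_gt0 L)) s_gt0.
  by rewrite pk_eq.
by apply: prod_pk_leq_expn; lia.
Qed.

End Maximizers.

Theorem theorem4p1 (k n : nat) (hk : 2 <= k) (hn : 1 <= n) :
  [/\ k = 2 ->
        (~~ odd n ->
           (forall L : colored_partition k n,
              maximizer L <-> has_sizes (nseq n./2 2) L)
           /\ max_pk k n = 5 ^ (n./2))
        /\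
        (odd n ->
           (forall L : colored_partition k n,
              maximizer L <->
                (exists2 m, 2 * m + 3 = n & has_sizes (3 :: nseq m 2) L)
                \/ (exists2 m, 2 * m + 1 = n & has_sizes (rcons (nseq m 2) 1) L))
           /\ max_pk k n = 2 * 5 ^ ((n - 1)./2)),
      k = 3 ->
        (forall L : colored_partition k n,
           maximizer L <->
             exists m l, 2 * m + l = n /\ has_sizes (nseq m 2 ++ nseq l 1) L)
        /\ max_pk k n = 3 ^ n
    & 4 <= k ->
        (forall L : colored_partition k n,
           maximizer L <-> has_sizes (nseq n 1) L)
        /\ max_pk k n = k ^ n].
Proof.
split=> [-> | -> | k4]; last exact: maximizer4P.
  have [maxP max_eq] := maximizer2P n; split=> n_odd; split=> [L|].
  - rewrite maxP /has_sizes -perm_all_nseq ?sumn_part_sizes //; last by lia.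
    rewrite -all_count_odd0 ?part_sizes_gt0 //.
    have := odd_sumn_count (part_sizes L); rewrite sumn_part_sizes (negPf n_odd).
    by case: (count odd _) => [|[|c]].
  - by rewrite max_eq /bound2 (negPf n_odd) mul1n.
  - rewrite maxP (@count_odd1P _ n./2) ?part_sizes_gt0 ?sumn_part_sizes //;
      last by lia.
    (* Next to a part 1 there are [n./2] twos; next to a part 3 there is one two fewer. *)
    split=> [[[n_gt1 ?]|?]|[[m m_eq ?]|[m m_eq ?]]].
    + by left; exists n./2.-1 => //; lia.
    + by right; exists n./2 => //; lia.
    + left; rewrite (_ : n./2.-1 = m); last by lia.
      by split=> //; lia.
    + by right; rewrite (_ : n./2 = m) //; lia.
  - by rewrite max_eq /bound2 n_odd; congr (2 * 5 ^ _); lia.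
have [maxP max_eq] := maximizer3P n; split=> // L; rewrite maxP; split=> [le2|].
  have L21 := perm_nseq21 (part_sizes_gt0 L) le2.
  exists (count_mem 2 (part_sizes L)), (count_mem 1 (part_sizes L)).
  split=> //; rewrite -[RHS](sumn_part_sizes L) (perm_sumn L21).
  by rewrite sumn_cat !sumn_nseq mul1n.
case=> m [l [_ /perm_all ->]].
by rewrite all_cat !all_nseq !orbT.
Qed.
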